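(* Let $m\geq 1$ and let $n\geq l\geq 1$ be integers, and let $X_1,\dots,X_m$ be elements of a commutative ring (e.g. indeterminates). For $i=1,\dots,m$ let $\mathbf{A}_i$ be the $l\times ml$ matrix whose entry in row $k$ and column $j$ ($1\le k\le l$, $1\le j\le ml$) is $\binom{n+j-1}{k-1}X_i^{j-1}$, i.e. $$\mathbf{A}_i=\begin{bmatrix}\binom{n}{0} & \binom{n+1}{0}X_i & \cdots & \binom{n+ml-1}{0}X_i^{ml-1}\\ \binom{n}{1} & \binom{n+1}{1}X_i & \cdots & \binom{n+ml-1}{1}X_i^{ml-1}\\ \vdots & \vdots & \ddots & \vdots\\ \binom{n}{l-1} & \binom{n+1}{l-1}X_i & \cdots & \binom{n+ml-1}{l-1}X_i^{ml-1}\end{bmatrix}.$$ Let $\mathbf{A}$ be the $ml\times ml$ matrix obtained by stacking $\mathbf{A}_1,\mathbf{A}_2,\dots,\mathbf{A}_m$ vertically in this order. Then $$\det\mathbf{A}=\prod_{i=1}^m X_i^{\frac{l(l-1)}{2}}\prod_{1\leq i<j\leq m}(X_j-X_i)^{l^2}.$$ *)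

(* Defs.v *)
From mathcomp Require Import all_boot all_order all_algebra.

Set Implicit Arguments.
Unset Strict Implicit.
Unset Printing Implicit Defensive.

Import GRing.Theory.
Local Open Scope ring_scope.

(* Rows k and columns j are numbered from 0, which turns the textbook entry
   binom(n + j - 1, k - 1) x^(j - 1), numbered from 1, into the one below. *)
Definition binom_block (R : comPzRingType) (n l p : nat) (x : R) : 'M[R]_(l, p) :=
  \matrix_(k < l, j < p) ('C(n + j, k)%:R * x ^+ j).

Lemma sum_ord_const (m l : nat) : (\sum_(i < m) l = m * l)%N.
Proof. by rewrite sum_nat_const card_ord. Qed.

(* [\mxcol] stacks the blocks vertically in increasing order of i; the cast only
   rewrites its number of rows, \sum_(i < m) l, to m * l. *)
Definition stacked_binom_mx (R : comPzRingType) (m n l : nat) (X : 'I_m -> R) :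
    'M[R]_(m * l) :=
  castmx (sum_ord_const m l, erefl (m * l)%N)
    (\mxcol_(i < m) binom_block n l (m * l) (X i)).

(* Main.v *)
(* Let L_(i,k) be the functional on polynomials of degree < ml whose values on
   the powers of the variable T form row (i, k) of the matrix.  Then L_(i,k)(p)
   is the coefficient of V^k in (1 + V)^n * p(x_i (1 + V)).  In the Newton basis
   N_(b,t) = prod_(a < b) (T - x_a)^l * (T - x_b)^t, ordered lexicographically,
   the functionals become lower triangular: substituting T = x_i (1 + V) turns
   T - x_i into x_i V, so that N_(b,t) contributes a factor V^l if i < b and a
   factor V^t if i = b.  The diagonal entries are
   x_b^t * prod_(a < b) (x_b - x_a)^l, and the change of basis is unitriangular
   because the N_(b,t) are monic. *)
From HB Require Import structures.
Require Import Defs.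
From mathcomp Require Import all_boot all_order all_algebra.
From mathcomp Require Import zify.

Import GRing.Theory.
Local Open Scope ring_scope.

Lemma castmx_mxcolE (T : Type) (m l p : nat) (B : 'I_m -> 'M[T]_(l, p))
    (e : ((\sum_(i < m) l) = m * l)%N) (r : 'I_(m * l)) (c : 'I_p)
    (i : 'I_m) (k : 'I_l) :
  (r = i * l + k :> nat)%N ->
  castmx (e, erefl p) (\mxcol_(i < m) B i) r c = B i k c.
Proof.
move=> rE; rewrite castmxE /= cast_ord_id mxE.
set s := cast_ord _ r.
have : (s = i * l + k :> nat)%N by [].
rewrite (tagnat.rect s).
(* The blocks before [sig1 s] have [l] rows each, so [E] compares two Euclidean divisions by [l],
   and uniqueness identifies the indices. *)
rewrite (big_ord_narrow (ltnW (ltn_ord _))) sum_nat_const card_ord.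
move: (tagnat.sig1 s) (tagnat.sig2 s) => i' k' E.
have l_gt0 : (0 < l)%N by apply: leq_ltn_trans (ltn_ord k).
have := congr1 (divn^~ l) E; have := congr1 (modn^~ l) E.
rewrite !modnMDl !divnMDl // !modn_small // !divn_small // !addn0.
by move=> /val_inj-> /val_inj->.
Qed.

Section NewtonBasis.

Variables (R : comNzRingType) (n l : nat) (y : nat -> R).

Definition twist (x : R) (p : {poly R}) : {poly R} :=
  ('X + 1) ^+ n * (p \Po (x *: ('X + 1))).

(** A monomial ['X^j] twists to [x ^+ j *: ('X + 1) ^+ (n + j)], which the binomial theorem expands.
    The slack in [N] lets one matrix width serve polynomials of all smaller sizes. *)
Lemma coef_twist (x : R) (p : {poly R}) (N k : nat) : (size p <= N)%N ->
  (twist x p)`_k = \sum_(j < N) 'C(n + j, k)%:R * x ^+ j * p`_j.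
Proof.
move=> pN.
have X1E q : (('X + 1 : {poly R}) ^+ q)`_k = 'C(q, k)%:R.
  rewrite addrC exprDn coef_sum.
  under eq_bigr => i _ do rewrite expr1n mul1r coefMn coefXn.
  have [kq|qk] := leqP k q.
    rewrite (bigD1 (Ordinal (kq : (k < q.+1)%N))) //= eqxx big1 ?addr0 //.
    by move=> i; rewrite -val_eqE eq_sym => /negbTE/= ->; rewrite mul0rn.
  rewrite bin_small // big1 // => i _.
  by rewrite gtn_eqF ?mul0rn // (leq_trans (ltn_ord i)).
rewrite /twist comp_polyE mulr_sumr coef_sum.
rewrite (big_ord_widen N (fun j => (('X + 1) ^+ n * (p`_j *: (x *: ('X + 1)) ^+ j))`_k)) //.
rewrite big_mkcond /=; apply: eq_bigr => j _; case: ltnP => [_|pj].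
  by rewrite exprZn -!scalerAr !coefZ -exprD X1E mulrC [x ^+ _ * _]mulrC.
by rewrite [p`_j]nth_default // mulr0.
Qed.

Definition newton_poly (b t : nat) : {poly R} :=
  (\prod_(a < b) ('X - (y a)%:P)) ^+ l * ('X - (y b)%:P) ^+ t.

Lemma newton_poly_monic (b t : nat) : newton_poly b t \is monic.
Proof.
by rewrite rpredM // rpredX ?monicXsubC // monic_prod_XsubC.
Qed.

Lemma size_newton_poly (b t : nat) : size (newton_poly b t) = (b * l + t).+1.
Proof.
rewrite /newton_poly; set w := \prod_(a < b) _.
have w_monic : w \is monic by apply: monic_prod_XsubC.
have size_w : size w = b.+1.
  by rewrite size_prod_XsubC -[index_enum _]enumT size_enum_ord.
have size_wX : size (w ^+ l) = (b * l).+1.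
  elim: l => [|k IHk]; first by rewrite expr0 size_poly1 muln0.
  by rewrite exprS size_monicM ?monic_neq0 ?monic_exp // size_w IHk; lia.
rewrite size_monicM ?monic_neq0 ?monic_exp ?monicXsubC // size_wX.
by rewrite size_exp_XsubC addnS.
Qed.

(** Only one factor keeps [('X + 1) ^+ n], so powers of ['X] can be pulled out of the other. *)
Lemma twistM (x : R) (p q : {poly R}) :
  twist x (p * q) = (p \Po (x *: ('X + 1))) * twist x q.
Proof. by rewrite /twist comp_polyM mulrCA. Qed.

Lemma comp_XsubC_exp (x : R) (t : nat) :
  (('X - x%:P) ^+ t) \Po (x *: ('X + 1)) = 'X^t * (x ^+ t)%:P.
Proof.
rewrite rmorphXn /= comp_polyB comp_polyX comp_polyC scalerDr alg_polyC addrK.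
by rewrite exprZn mulrC mul_polyC.
Qed.

Lemma twist_newton_lt (i b k t : nat) : (i < b)%N -> (k < l)%N ->
  (twist (y i) (newton_poly b t))`_k = 0.
Proof.
move=> ib kl; rewrite /newton_poly (bigD1 (Ordinal ib)) //= exprMn -mulrA.
by rewrite twistM comp_XsubC_exp -mulrA coefXnM kl.
Qed.

Lemma twist_newton_ltr (b k t : nat) : (k < t)%N ->
  (twist (y b) (newton_poly b t))`_k = 0.
Proof.
by move=> kt; rewrite /newton_poly mulrC twistM comp_XsubC_exp -mulrA coefXnM kt.
Qed.

Lemma twist_newton_diag (b t : nat) :
  (twist (y b) (newton_poly b t))`_t =
    y b ^+ t * \prod_(a < b) (y b - y a) ^+ l.
Proof.
rewrite /newton_poly mulrC twistM comp_XsubC_exp -mulrA coefXnM ltnn subnn.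
(* With ['X^t] removed, the constant term is left: the value at 0, where ['X + 1] is 1 and the
   substituted point is [y b]. *)
rewrite coefCM /twist -horner_coef0 hornerM horner_exp horner_comp !hornerE.
rewrite /= expr1n mulr1 horner_prod prodrXl; congr (_ * _ ^+ _).
by apply: eq_bigr => a _; rewrite !hornerE.
Qed.

Lemma det_binom_mx (m : nat) : (0 < l)%N ->
  \det (\matrix_(r < m * l, c < m * l)
          ('C(n + c, r %% l)%:R * y (r %/ l) ^+ c)) =
    (\prod_(i < m) y i ^+ (l * (l - 1) %/ 2)) *
    \prod_(i < m) \prod_(a < i) (y i - y a) ^+ (l ^ 2).
Proof.
move=> l_gt0; set A := \matrix_(_, _) _.
(* Quotient and remainder by [l] encode the lexicographic order on pairs, so [N c] has degree
   exactly [c]. *)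
pose N c := newton_poly (c %/ l) (c %% l).
have sizeN c : size (N c) = c.+1 by rewrite size_newton_poly -divn_eq.
pose P := \matrix_(j < m * l, c < m * l) (N c)`_j.
have detP : \det P = 1.
  rewrite -det_tr det_trig.
    apply: big1 => c _; rewrite !mxE.
    by have /monicP := newton_poly_monic (c %/ l) (c %% l);
      rewrite lead_coefE sizeN.
  by apply/is_trig_mxP => i j ij; rewrite !mxE nth_default // sizeN.
have AP r c : (A *m P) r c = (twist (y (r %/ l)) (N c))`_(r %% l).
  rewrite (@coef_twist _ _ (m * l)) ?sizeN //.
  by rewrite mxE; apply: eq_bigr => j _; rewrite !mxE.
have -> : \det A = \det (A *m P) by rewrite det_mulmx detP mulr1.
rewrite det_trig; last first.
  apply/is_trig_mxP => r c rc; rewrite AP.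
  (* For [r < c], either both lie in the same block and the remainders increase, or the block of [r]
     comes strictly earlier. *)
  have := leq_div2r l (ltnW rc); rewrite leq_eqVlt => /predU1P[E|lt_b].
    rewrite /N -E twist_newton_ltr // -(ltn_add2l (c %/ l * l)).
    by rewrite -[ltnRHS]divn_eq -E -divn_eq.
  by rewrite twist_newton_lt // ltn_pmod.
under eq_bigr => r _ do rewrite AP twist_newton_diag.
(* As a function on [nat], the diagonal can be cut into [m] runs of length [l]. *)
rewrite -(big_mkord xpredT
  (fun r => y (r %/ l) ^+ (r %% l) * \prod_(a < r %/ l) (y (r %/ l) - y a) ^+ l)).
rewrite big_nat_mul big_mkord -big_split /=; apply: eq_bigr => i _.
rewrite mulSn addnC -{1}[(i * l)%N]add0n big_addn addKn big_mkord.
have E (k : 'I_l) : ((k + i * l) %/ l = i)%N /\ ((k + i * l) %% l = k)%N.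
  by rewrite addnC modnMDl divnMDl // modn_small // divn_small // addn0.
transitivity (\prod_(k < l) (y i ^+ k * \prod_(a < i) (y i - y a) ^+ l)).
  by apply: eq_bigr => k _; have [-> ->] := E k.
rewrite big_split /= prodr_const card_ord prodrXl -exprM mulnn; congr (_ * _).
  by rewrite -expr_sum -(big_mkord xpredT id) bin2_sum bin2 subn1 divn2.
by rewrite prodrXl.
Qed.

End NewtonBasis.

Lemma det_stacked_binom_mx (R : comNzRingType) (m n l : nat) (X : 'I_m -> R) :
    (0 < l)%N ->
  \det (stacked_binom_mx n l X) =
    (\prod_(i < m) X i ^+ (l * (l - 1) %/ 2)) *
    \prod_(i < m) \prod_(j < m | (i < j)%N) (X j - X i) ^+ (l ^ 2).
Proof.
move=> l_gt0.
(* The default 0 is never reached: every index used is below [m]. *)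
pose y i := if insub i is Some o then X o else 0.
have yE (i : 'I_m) : y i = X i by rewrite /y valK.
transitivity (\det (\matrix_(r < m * l, c < m * l)
                ('C(n + c, r %% l)%:R * y (r %/ l)%N ^+ c))).
  congr (\det _); apply/matrixP => r c; rewrite [RHS]mxE.
  have rm : (r %/ l < m)%N by rewrite ltn_divLR.
  rewrite (@castmx_mxcolE _ _ _ _ _ _ _ _ (Ordinal rm) (Ordinal (ltn_pmod r l_gt0))).
    by rewrite mxE -yE.
  exact: divn_eq.
rewrite det_binom_mx //; congr (_ * _).
  by apply: eq_bigr => i _; rewrite yE.
(* Group the pairs by their larger index, as in [det_binom_mx]. *)
rewrite [RHS](exchange_big_dep xpredT) //=; apply: eq_bigr => j _.
rewrite (big_ord_narrow (ltnW (ltn_ord j))).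
by apply: eq_bigr => a _; rewrite -!yE.
Qed.

(* Polynomials are only available over nonzero rings. *)
Definition nonzero_copy (R : comPzRingType) (R_nz : 1 != 0 :> R) : Type := R.

HB.instance Definition _ (R : comPzRingType) (R_nz : 1 != 0 :> R) :=
  GRing.ComPzRing.on (nonzero_copy R R_nz).
HB.instance Definition _ (R : comPzRingType) (R_nz : 1 != 0 :> R) :=
  GRing.PzSemiRing_isNonZero.Build (nonzero_copy R R_nz) R_nz.

Theorem theorem2 (R : comPzRingType) (m n l : nat) (X : 'I_m -> R)
    (hm : (1 <= m)%N) (hl : (1 <= l)%N) (hln : (l <= n)%N) :
  \det (stacked_binom_mx n l X) =
    (\prod_(i < m) X i ^+ (l * (l - 1) %/ 2)) *
    \prod_(i < m) \prod_(j < m | (i < j)%N) (X j - X i) ^+ (l ^ 2).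
Proof.
(* When 1 = 0 any two elements coincide; otherwise [nonzero_copy] unfolds to [R] with the same
   operations, so both statements are convertible. *)
have [R0|R_nz] := eqVneq (1 : R) 0.
  by rewrite -[LHS]mul1r -[RHS]mul1r R0 !mul0r.
exact: (@det_stacked_binom_mx (nonzero_copy R R_nz) m n l X hl).
Qed.
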